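(* Let $k$ be a field, let $G$ be a finite forest with vertex set $V_G=\{x_1,\ldots,x_n\}$ and edge set $E_G$, and let $I(G)\subseteq R=k[x_1,\ldots,x_n]$ be its edge ideal. Then $\beta_{0,2}(I(G)) = \#E_G$, and $$\beta_{i,i+2}(I(G)) = \sum_{v \in V_G} \binom{\deg v}{i+1}\quad\text{for all } i \geq 1.$$
   Context: Graphs are simple (no loops or multiple edges) and need not be connected. A forest is a graph with no induced cycles (equivalently, an acyclic graph). The edge ideal of $G$ is $I(G)=\langle x_ix_j \mid \{x_i,x_j\}\in E_G\rangle\subseteq R=k[x_1,\ldots,x_n]$. For a homogeneous ideal $I\subseteq R$ (standard grading), the graded Betti numbers are $\beta_{i,j}(I)=\dim_k \operatorname{Tor}^R_i(I,k)_j$. The degree $\deg v$ of a vertex $v$ is the number of edges incident to $v$. *)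

(* Defs.v *)
From mathcomp Require Import all_boot all_order all_algebra.
From mathcomp Require Import mpoly.
From Stdlib Require Import ClassicalEpsilon.

Set Implicit Arguments.
Unset Strict Implicit.
Unset Printing Implicit Defensive.

Import GRing.Theory.
Local Open Scope ring_scope.

Record simple_graph (T : finType) := SimpleGraph {
  adj :> rel T;
  adj_sym : ssrbool.symmetric adj;
  adj_irrefl : irreflexive adj
}.

Definition edges (T : finType) (G : simple_graph T) : {set {set T}} :=
  [set [set p.1; p.2] | p : T * T & G p.1 p.2].

Definition degree (T : finType) (G : simple_graph T) (v : T) : nat :=
  #|[set A in edges G | v \in A]|.

(* The vertices of s, in this cyclic order, induce a cycle: the edges of G    *)
(* between members of s are exactly those joining cyclic neighbours.          *)
Definition induced_cycle (T : finType) (G : simple_graph T) (s : seq T) : Prop :=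
  [/\ (2 < size s)%N, uniq s &
      {in s &, forall x y, G x y = (y == next s x) || (x == next s y)}].

Definition is_forest (T : finType) (G : simple_graph T) : Prop :=
  forall s : seq T, ~ induced_cycle G s.

Definition ideal_span (R : comNzRingType) (S : R -> Prop) (p : R) : Prop :=
  exists (m : nat) (c g : 'I_m -> R),
    (forall a, S (g a)) /\ p = \sum_(a < m) c a * g a.

Definition edge_ideal (k : fieldType) (n : nat) (G : simple_graph 'I_n) :
    {mpoly k[n]} -> Prop :=
  ideal_span (fun p => exists x y : 'I_n, G x y /\ p = 'X_x * 'X_y).
Arguments edge_ideal k {n} G _.

(* A resolution ... -> F_1 -> F_0 -> I -> 0 by finitely generated graded free *)
(* modules over R = k[x_1..x_n], with maps homogeneous of degree 0.           *)
(* F_i is the direct sum of the R(-gdeg i r) for r < grank i; its elements    *)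
(* are row vectors, and the maps act by multiplication on the right.          *)
Record graded_free_resolution (k : fieldType) (n : nat)
    (I : {mpoly k[n]} -> Prop) := GradedFreeResolution {
  grank : nat -> nat;
  gdeg : forall i, 'I_(grank i) -> nat;
  gdiff : forall i, 'M[{mpoly k[n]}]_(grank i.+1, grank i);
  gaug : 'cV[{mpoly k[n]}]_(grank 0);
  gdiff_homog : forall i r s,
    if (gdeg s <= gdeg r)%N
    then gdiff i r s \is (gdeg r - gdeg s).-homog
    else gdiff i r s == 0;
  gaug_homog : forall r, gaug r 0 \is (gdeg r).-homog;
  gaug_image : forall p,
    I p <-> exists u : 'rV[{mpoly k[n]}]_(grank 0), p = (u *m gaug) 0 0;
  gaug_exact : forall u : 'rV[{mpoly k[n]}]_(grank 0),
    u *m gaug = 0 <-> exists w, u = w *m gdiff 0;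
  gdiff_exact : forall i (u : 'rV[{mpoly k[n]}]_(grank i.+1)),
    u *m gdiff i = 0 <-> exists w, u = w *m gdiff i.+1
}.

Section Tor.
Variables (k : fieldType) (n : nat) (I : {mpoly k[n]} -> Prop).
Variable F : graded_free_resolution I.

(* The differential of F (x)_R k, where k = R / (x_1, .., x_n): only the      *)
(* constant coefficients of the matrix entries survive.                       *)
Definition tensor_diff (i : nat) : 'M[k]_(grank F i.+1, grank F i) :=
  map_mx (mcoeff 0%MM) (gdiff F i).

(* Row space: the degree j component of F_i (x)_R k, spanned by the basis     *)
(* vectors of degree j.                                                       *)
Definition tensor_part (i j : nat) : 'M[k]_(grank F i) :=
  diag_mx (\row_r (gdeg (g := F) r == j)%:R).

Definition tensor_cycles (i j : nat) : 'M[k]_(grank F i) :=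
  match i return 'M[k]_(grank F i) with
  | 0 => tensor_part 0 j
  | i'.+1 => (tensor_part i'.+1 j :&: kermx (tensor_diff i'))%MS
  end.

Definition tensor_boundaries (i j : nat) : 'M[k]_(grank F i.+1, grank F i) :=
  tensor_part i.+1 j *m tensor_diff i.

(* dim_k H_i(F (x)_R k)_j = dim_k Tor_i^R(I, k)_j; the boundaries lie in the  *)
(* cycles, so the subtraction does not truncate.                              *)
Definition tor_dim (i j : nat) : nat :=
  \rank (tensor_cycles i j) - \rank (tensor_boundaries i j).

End Tor.

(* The value of [tor_dim F i j], the same for every resolution F of I; such an *)
(* F exists, by Hilbert's basis theorem, when I is a homogeneous ideal.        *)
Definition graded_betti (k : fieldType) (n : nat) (I : {mpoly k[n]} -> Prop)
    (i j : nat) : nat :=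
  epsilon (inhabits 0%N)
    (fun b => exists F : graded_free_resolution I, tor_dim F i j = b).

(* Main.v *)
Require Import Defs.
From mathcomp Require Import all_boot all_order all_algebra.
From mathcomp Require Import mpoly.
From Stdlib Require Import ClassicalEpsilon.

(** Two ingredients reduce the statement to counting. First, [graded_betti] may
    be computed from any graded free resolution ([graded_bettiE]): the identity
    of the ideal lifts to degree-preserving chain maps between two resolutions,
    in both directions, and their composite is homotopic to the identity, so
    after tensoring with [k] the homology of one embeds into that of the other.
    Second, an ideal generated by monomials [m_e] has an explicit resolution,
    due to Taylor: its basis in homological degree [i] consists of the sets [A]
    of [i + 1] generators, placed in degree [deg lcm(m_e, e in A)], and its
    differential is that of a simplex, rescaled by quotients of lcms
    ([taylor_resolution]).

    For an edge ideal, the lcm of a set [A] of edges is the product of the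
    vertices covered by [A], so the part of the Taylor complex relevant to
    [beta_(i, i+2)] consists of the sets of [i + 1] edges that cover [i + 2]
    vertices. In a forest a nonempty set of edges covers more vertices than it
    has edges ([forest_card_cover]). Hence no set of [i + 2] edges covers only
    [i + 2] vertices, and there are no boundaries. Moreover a set of edges with
    exactly one more vertex than edges, a tree, is determined by the vertices
    that it covers ([forest_cover_inj]). After tensoring with [k] the
    differential sends such an [A] to the signed sum of the [A \ e] that cover
    the same vertices, and by this uniqueness distinct [A] have disjoint
    images. So the cycles are spanned by the trees [A] from which no edge can
    be removed without uncovering a vertex. Every edge then owns a vertex of
    its own, which leaves only one vertex to be shared: [A] is a star
    ([irredundant_star]). As a star with at least two edges has a unique
    centre, [sum_v 'C(deg v, i + 1)] counts them when [i >= 1] ([card_stars]).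
    In homological degree 0 there is no differential to be killed by, and all
    edges are cycles. *)

Set Implicit Arguments.
Unset Strict Implicit.
Unset Printing Implicit Defensive.
Import GRing.Theory.

(** * Homogeneous matrices over the polynomial ring *)

Section HomogeneousMatrices.
Local Open Scope ring_scope.
Variables (k : fieldType) (n : nat).
Local Notation R := {mpoly k[n]}.

(** [M] represents a degree-preserving map from the sum of the [R(- a r)] to the
    sum of the [R(- b s)]. Putting the condition on coefficients avoids the
    truncated difference [a r - b s]. *)
Definition homog_mx p q (a : 'I_p -> nat) (b : 'I_q -> nat) (M : 'M[R]_(p, q)) :=
  forall r s m, (M r s)@_m != 0 -> (mdeg m + b s)%N = a r.

(** Degree-preserving component of [M]. It turns an arbitrary factorization of a
    homogeneous matrix into a homogeneous one, by [homog_part_mulmx]. *)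
Definition homog_part p q (a : 'I_p -> nat) (b : 'I_q -> nat) (M : 'M[R]_(p, q)) :
    'M[R]_(p, q) :=
  \matrix_(r, s)
    \sum_(m <- msupp (M r s) | (mdeg m + b s == a r)%N) (M r s)@_m *: 'X_[m].

Lemma mcoeff_homog_part p q a b (M : 'M[R]_(p, q)) r s m :
  (homog_part a b M r s)@_m =
    if (mdeg m + b s == a r)%N then (M r s)@_m else 0.
Proof.
rewrite mxE linear_sum /=.
under eq_bigr => m' _ do rewrite linearZ /= mcoeffX.
have [m_supp|m_nsupp] := boolP (m \in msupp (M r s)); last first.
  have /eqP M0 : (M r s)@_m == 0 by rewrite mcoeff_eq0.
  rewrite M0 if_same big_seq_cond big1 // => m' /andP[m'_supp _].
  case: eqP => [mm|]; last by rewrite mulr0.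
  by rewrite -mm m'_supp in m_nsupp.
rewrite big_mkcond (bigD1_seq m) ?msupp_uniq //= eqxx mulr1.
rewrite [X in _ + X]big1 ?addr0 // => m' /negPf mm.
by case: ifP => // _; rewrite mm mulr0.
Qed.

Lemma homog_part_homog p q a b (M : 'M[R]_(p, q)) : homog_mx a b (homog_part a b M).
Proof. by move=> r s m; rewrite mcoeff_homog_part; case: ifP => [/eqP//|_]; rewrite eqxx. Qed.

Lemma homog_part_id p q a b (M : 'M[R]_(p, q)) :
  homog_mx a b M -> homog_part a b M = M.
Proof.
move=> hM; apply/matrixP=> r s; apply/mpolyP=> m; rewrite mcoeff_homog_part.
by have [->|/hM->] := eqVneq (M r s)@_m 0; rewrite ?if_same ?eqxx.
Qed.

Lemma homog_part_mulmx p q t a b c (M : 'M[R]_(p, q)) (N : 'M[R]_(q, t)) :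
  homog_mx b c N -> homog_part a c (M *m N) = homog_part a b M *m N.
Proof.
move=> hN; apply/matrixP=> r s; apply/mpolyP=> m; rewrite mcoeff_homog_part !mxE.
rewrite !linear_sum /= -[RHS]mul1r.
transitivity (\sum_j (if (mdeg m + c s == a r)%N then (M r j * N j s)@_m else 0)).
  by case: ifP => // _; rewrite big1.
rewrite mul1r; apply: eq_bigr => j _; rewrite !mcoeffM.
transitivity (\sum_(k0 : 'X_{1..n < (mdeg m).+1, (mdeg m).+1} | m == (k0.1 + k0.2)%MM)
  (if (mdeg m + c s == a r)%N then (M r j)@_k0.1 * (N j s)@_k0.2 else 0)).
  by case: ifP => // _; rewrite big1.
apply: eq_bigr => -[m1 m2] /eqP/(congr1 mdeg) /=; rewrite mdegD mcoeff_homog_part => Dm.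
have [->|/hN <-] := eqVneq (N j s)@_m2 0; first by rewrite !mulr0 if_same.
by rewrite addnA -Dm; case: ifP; rewrite ?mul0r.
Qed.

Lemma homog_mulmx p q t a b c (M : 'M[R]_(p, q)) (N : 'M[R]_(q, t)) :
  homog_mx a b M -> homog_mx b c N -> homog_mx a c (M *m N).
Proof.
move=> hM hN; rewrite -(homog_part_id hM) -(homog_part_mulmx _ _ hN).
exact: homog_part_homog.
Qed.

Lemma homog_addmx p q a b (M N : 'M[R]_(p, q)) :
  homog_mx a b M -> homog_mx a b N -> homog_mx a b (M + N).
Proof.
move=> hM hN r s m; rewrite mxE mcoeffD => nz.
have [M0|/hM//] := eqVneq (M r s)@_m 0.
by apply: hN; rewrite M0 add0r in nz.
Qed.

Lemma homog_oppmx p q a b (M : 'M[R]_(p, q)) : homog_mx a b M -> homog_mx a b (- M).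
Proof. by move=> hM r s m; rewrite mxE mcoeffN oppr_eq0 => /hM. Qed.

Lemma homog_scalar1 p a : homog_mx a a (1%:M : 'M[R]_p).
Proof.
move=> r s m; rewrite mxE; have [->|_] := eqVneq r s; last by rewrite mcoeff0 eqxx.
rewrite mulr1n mcoeff1; have [->|_] := eqVneq m 0%MM; last by rewrite eqxx.
by rewrite mdeg0.
Qed.

Lemma homog_mxE p q a b (M : 'M[R]_(p, q)) :
  (forall r s, if (b s <= a r)%N then M r s \is (a r - b s).-homog else M r s == 0) ->
  homog_mx a b M.
Proof.
move=> hM r s m nz; have := hM r s; case: leqP => [le_ba|_ /eqP M0]; last first.
  by rewrite M0 mcoeff0 eqxx in nz.
move=> /dhomogP/(_ m); rewrite mcoeff_msupp => /(_ nz) ->.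
by rewrite subnK.
Qed.

Lemma homog_mx_sub p q a b (M : 'M[R]_(p, q)) r s : homog_mx a b M ->
  if (b s <= a r)%N then M r s \is (a r - b s).-homog else M r s == 0.
Proof.
move=> hM; case: leqP => [le_ba|lt_ab].
  by apply/dhomogP => m; rewrite mcoeff_msupp => /hM <-; rewrite addnK.
apply/eqP/mpolyP=> m; rewrite mcoeff0; have [//|/hM eq_ab] := eqVneq (M r s)@_m 0.
by move: lt_ab; rewrite -eq_ab ltnNge leq_addl.
Qed.

(** Projectivity of graded free modules: rows are lifted independently, and then
    only the homogeneous part of the lift is kept. *)
Lemma homog_factor p q t a b c (M : 'M[R]_(p, t)) (D : 'M[R]_(q, t)) :
  homog_mx a c M -> homog_mx b c D ->
  (forall r, exists w : 'rV_q, row r M = w *m D) ->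
  exists N, homog_mx a b N /\ M = N *m D.
Proof.
move=> hM hD /fin_all_exists [w Dw]; exists (homog_part a b (\matrix_r w r)).
split; first exact: homog_part_homog.
rewrite -(homog_part_mulmx _ _ hD) -[LHS](homog_part_id hM); congr homog_part.
by apply/row_matrixP=> r; rewrite Dw row_mul rowK.
Qed.

(** [M] tensored with [k = R / (x_1, .., x_n)]. *)
Definition const_part p q (M : 'M[R]_(p, q)) : 'M[k]_(p, q) := map_mx (mcoeff 0%MM) M.

(** For the degrees of the basis of a resolution this is [tensor_part]. *)
Definition deg_proj p (a : 'I_p -> nat) j : 'M[k]_p := diag_mx (\row_r (a r == j)%:R).

Lemma const_partM p q t (M : 'M[R]_(p, q)) (N : 'M[R]_(q, t)) :
  const_part (M *m N) = const_part M *m const_part N.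
Proof. exact: map_mxM. Qed.

Lemma const_partD p q (M N : 'M[R]_(p, q)) :
  const_part (M + N) = const_part M + const_part N.
Proof. exact: map_mxD. Qed.

(** A constant entry of a homogeneous matrix joins basis vectors of equal
    degree. *)
Lemma deg_proj_const p q a b j (M : 'M[R]_(p, q)) : homog_mx a b M ->
  deg_proj a j *m const_part M = const_part M *m deg_proj b j.
Proof.
move=> hM; apply/matrixP=> r s; rewrite mul_diag_mx mul_mx_diag !mxE.
have [->|/hM] := eqVneq (M r s)@_0 0; first by rewrite mulr0 mul0r.
by rewrite mdeg0 add0n mulrC => ->.
Qed.

Lemma sub_deg_proj p q a j (A : 'M[k]_(q, p)) :
  (A <= deg_proj a j)%MS -> A *m deg_proj a j = A.
Proof.
case/submxP=> B ->; rewrite -mulmxA; congr (_ *m _).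
apply/matrixP=> r s; rewrite mul_diag_mx !mxE.
by case: (a r == j); rewrite ?mul1r ?mul0r ?mul0rn.
Qed.
End HomogeneousMatrices.

(** * Ranks of matrices over a field *)

Section SubquotientRank.
Local Open Scope ring_scope.
Variables (k : fieldType) (p q : nat).

(** Maps [f] and [g] between subquotients [Z / B] and [Z' / B'] such that [g]
    after [f] is the identity of [Z / B] make [f] injective. The proof realizes
    [Z / B] as a complement [C] of [B] in [Z]: then [f] is injective on [C] and
    [C f] meets [B'] trivially. *)
Lemma subquotient_rank_le m1 m2 m3 m4 (Z : 'M[k]_(m1, p)) (B : 'M[k]_(m2, p))
    (Z' : 'M[k]_(m3, q)) (B' : 'M[k]_(m4, q)) (f : 'M[k]_(p, q)) (g : 'M[k]_(q, p)) :
  (Z *m f <= Z')%MS -> (B' <= Z')%MS -> (B' *m g <= B)%MS ->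
  (Z *m (f *m g - 1%:M) <= B)%MS ->
  (\rank Z - \rank B <= \rank Z' - \rank B')%N.
Proof.
move=> Zf BZ Bg fg1.
pose C := (Z :\: B)%MS.
have sCZ : (C <= Z)%MS by exact: diffmxSl.
have key m (u : 'M_(m, p)) : (u <= C)%MS -> (u *m f <= B')%MS -> u = 0.
  move=> uC ufB; apply/eqP; rewrite -submx0.
  rewrite -(capmx_diff Z B) -/C.
  have uB : (u <= B)%MS.
    have -> : u = u *m f *m g - u *m (f *m g - 1%:M).
      by rewrite mulmxBr mulmx1 mulmxA opprB addrC subrK.
    rewrite addmx_sub ?eqmx_opp //; first exact: submx_trans (submxMr _ ufB) Bg.
    exact: submx_trans (submxMr _ (submx_trans uC sCZ)) fg1.
  by rewrite sub_capmx uC.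
have Cf : \rank (C *m f) = \rank C.
  rewrite -[RHS](mxrank_mul_ker C f).
  suff -> : (C :&: kermx f)%MS = 0 by rewrite mxrank0 addn0.
  apply: key; first exact: capmxSl.
  by have /sub_kermxP -> := capmxSr C (kermx f); rewrite sub0mx.
have CfB : (C *m f :&: B')%MS = 0.
  have /submxP[D DE] := capmxSl (C *m f) B'.
  rewrite mulmxA in DE.
  rewrite DE [D *m C]key ?mul0mx ?submxMl // -DE; exact: capmxSr.
have : (C *m f + B' <= Z')%MS.
  by rewrite addsmx_sub BZ andbT (submx_trans (submxMr _ sCZ)).
move/mxrankS; have := mxrank_sum_cap (C *m f) B'; rewrite CfB mxrank0 addn0 Cf => ->.
move=> le; have := mxrank_cap_compl Z B; rewrite -/C.
have := mxrankS (capmxSr Z B) => leB rZ.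
have leZ: (\rank Z - \rank B <= \rank C)%N by rewrite leq_subLR -rZ leq_add2r.
by apply: leq_trans leZ _; rewrite leq_subRL 1?addnC // (leq_trans (leq_addl _ _) le).
Qed.
End SubquotientRank.

Section DiagonalRank.
Local Open Scope ring_scope.
Variables (k : fieldType) (p : nat).

(** The diagonal 0-1 matrix factors through its nonzero coordinates as
    [S^T *m S], where [S *m S^T] is the identity. *)
Lemma mxrank_diag_pred (b : pred 'I_p) :
  \rank (diag_mx (\row_r (b r)%:R) : 'M[k]_p) = #|b|.
Proof.
pose S : 'M[k]_(#|b|, p) := \matrix_(i, j) (enum_val i == j)%:R.
have SSt : S *m S^T = 1%:M.
  apply/matrixP=> i j; rewrite !mxE (bigD1 (enum_val i)) //= !mxE eqxx mul1r.
  rewrite (inj_eq enum_val_inj) eq_sym big1 ?addr0 // => l /negPf il.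
  by rewrite !mxE eq_sym il mul0r.
have StS : S^T *m S = diag_mx (\row_r (b r)%:R).
  apply/matrixP=> r s; rewrite !mxE.
  under eq_bigr => i _ do rewrite !mxE.
  rewrite -(big_enum_val (fun x => (x == r)%:R * (x == s)%:R)) /= big_mkcond (bigD1 r) //=.
  rewrite big1 => [|x /negPf xr]; last by rewrite xr mul0r if_same.
  rewrite eqxx mul1r addr0 unfold_in.
  by case: (b r); rewrite ?mul0rn // mulr_natr mulr1n.
rewrite -StS; apply/eqP; rewrite eqn_leq (leq_trans (mxrankM_maxr _ _)) ?rank_leq_row //=.
have {1}<- : \rank (S *m (S^T *m S) *m S^T) = #|b|.
  by rewrite mulmxA SSt mul1mx SSt mxrank1.
exact: leq_trans (mxrankM_maxl _ _) (mxrankM_maxr _ _).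
Qed.

End DiagonalRank.

(** * Betti numbers computed from an arbitrary resolution *)

Lemma dependent_choice (T : nat -> Type) (P : forall i, T i -> Prop)
    (Q : forall i, T i -> T i.+1 -> Prop) (x0 : T 0) :
  P 0 x0 -> (forall i x, P i x -> exists y, P i.+1 y /\ Q i x y) ->
  exists f : forall i, T i, f 0 = x0 /\ forall i, P i (f i) /\ Q i (f i) (f i.+1).
Proof.
move=> P0 step.
pose next i (x : {x : T i | P i x}) :=
  constructive_indefinite_description _ (step i (sval x) (svalP x)).
pose g := fix g i : {x : T i | P i x} :=
  if i is i'.+1 then exist _ (sval (next i' (g i'))) (proj1 (svalP (next i' (g i'))))
  else exist _ x0 P0.
exists (fun i => sval (g i)); split=> // i; split; first exact: (svalP (g i)).
exact: (proj2 (svalP (next i (g i)))).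
Qed.

Section AugmentedResolution.
Local Open Scope ring_scope.
Variables (k : fieldType) (n : nat) (I : {mpoly k[n]} -> Prop).
Local Notation R := {mpoly k[n]}.
Implicit Types F : graded_free_resolution I.

(** The resolution [.. -> F_1 -> F_0 -> R], with [R] put in position 0: chain
    maps and homotopies are then built by a uniform induction that starts from
    the identity and the zero map of [R]. *)
Definition aug_rank F i := if i is i'.+1 then grank F i' else 1%N.

Definition aug_deg F i : 'I_(aug_rank F i) -> nat :=
  match i with 0 => fun=> 0%N | i'.+1 => @gdeg _ _ _ F i' end.

Definition aug_diff F i : 'M[R]_(aug_rank F i.+1, aug_rank F i) :=
  match i with 0 => gaug F | i'.+1 => gdiff F i' end.

Arguments aug_deg : clear implicits.

Lemma aug_diff_homog F i : homog_mx (aug_deg F i.+1) (aug_deg F i) (aug_diff F i).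
Proof.
case: i => [|i]; apply: homog_mxE => r s; last exact: gdiff_homog.
by rewrite /= subn0 ord1; exact: gaug_homog.
Qed.

Arguments aug_diff_homog : clear implicits.

Lemma aug_diff_exact F i (u : 'rV[R]_(aug_rank F i.+1)) :
  u *m aug_diff F i = 0 -> exists w, u = w *m aug_diff F i.+1.
Proof. by case: i u => [|i] u; [move/gaug_exact | move/gdiff_exact]. Qed.

Lemma aug_diffK F i : aug_diff F i.+1 *m aug_diff F i = 0.
Proof.
apply/row_matrixP=> r; rewrite row_mul row0.
case: i r => [|i] r; [apply/gaug_exact | apply/gdiff_exact].
  by exists (delta_mx 0 r); rewrite -rowE.
by exists (delta_mx 0 r); rewrite -rowE.
Qed.

Lemma aug_factor F i p (a : 'I_p -> nat) (M : 'M[R]_(p, aug_rank F i.+1)) :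
  homog_mx a (aug_deg F i.+1) M -> M *m aug_diff F i = 0 ->
  exists N, homog_mx a (aug_deg F i.+2) N /\ M = N *m aug_diff F i.+1.
Proof.
move=> hM Md0; apply: (homog_factor hM (aug_diff_homog F i.+1)) => r.
by apply: aug_diff_exact; rewrite -row_mul Md0 row0.
Qed.

(** A lift [f i] can be continued as soon as [aug_diff F i *m f i] factors
    through [aug_diff F' i]; the factor found is [f i.+1], and exactness of [F']
    shows that it can be continued in turn. *)
Lemma comparison_map F F' :
  exists f : forall i, 'M[R]_(aug_rank F i, aug_rank F' i),
    [/\ f 0 = 1%:M,
        forall i, homog_mx (aug_deg F i) (aug_deg F' i) (f i) &
        forall i, aug_diff F i *m f i = f i.+1 *m aug_diff F' i].
Proof.
pose P i (f : 'M[R]_(aug_rank F i, aug_rank F' i)) :=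
  homog_mx (aug_deg F i) (aug_deg F' i) f /\
  exists g, homog_mx (aug_deg F i.+1) (aug_deg F' i.+1) g /\
            aug_diff F i *m f = g *m aug_diff F' i.
pose Q i (f : 'M[R]_(aug_rank F i, aug_rank F' i)) g :=
  aug_diff F i *m f = g *m aug_diff F' i.
have P0 : P 0 1%:M.
  split; first exact: homog_scalar1.
  rewrite mulmx1.
  apply: (homog_factor (aug_diff_homog F 0) (aug_diff_homog F' 0)) => r /=.
  have /(gaug_image F') [u Du] : I ((row r (gaug F)) 0 0).
    by apply/(gaug_image F); exists (delta_mx 0 r); rewrite -rowE.
  by exists u; apply/matrixP=> i j; rewrite !ord1.
have step i f : P i f -> exists g, P i.+1 g /\ Q i f g.
  case=> hf [g [hg Dg]]; exists g; split=> //; split=> //.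
  apply: aug_factor; first exact: homog_mulmx (aug_diff_homog F _) hg.
  by rewrite -mulmxA -Dg mulmxA aug_diffK mul0mx.
have [f [f0 fP]] := dependent_choice P0 step.
exists f; split=> // i; first by case: (fP i) => [[]].
by case: (fP i).
Qed.

(** Since [t 0 = 0], the homotopy can start with [h = 0] on [R]. This is what
    makes the term [aug_diff F 0 *m h] vanish in homological degree 0, where
    cycles are not required to be killed by the augmentation. *)
Lemma null_homotopy F (t : forall i, 'M[R]_(aug_rank F i)) :
    t 0 = 0 -> (forall i, homog_mx (aug_deg F i) (aug_deg F i) (t i)) ->
    (forall i, aug_diff F i *m t i = t i.+1 *m aug_diff F i) ->
  forall i, exists (h : 'M[R]_(aug_rank F i, aug_rank F i.+1))
                   (h' : 'M[R]_(aug_rank F i.+1, aug_rank F i.+2)),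
    [/\ i = 0 -> h = 0, homog_mx (aug_deg F i.+1) (aug_deg F i.+2) h' &
        t i.+1 = aug_diff F i *m h + h' *m aug_diff F i.+1].
Proof.
move=> t0 ht dt.
have step i h : homog_mx (aug_deg F i) (aug_deg F i.+1) h ->
    aug_diff F i *m (t i - h *m aug_diff F i) = 0 ->
  exists h', homog_mx (aug_deg F i.+1) (aug_deg F i.+2) h' /\
    t i.+1 = aug_diff F i *m h + h' *m aug_diff F i.+1.
  move=> hh th0.
  have [||h' [hh' Dh']] :=
    @aug_factor F i _ (aug_deg F i.+1) (t i.+1 - aug_diff F i *m h).
  - apply: homog_addmx => //; apply: homog_oppmx.
    exact: homog_mulmx (aug_diff_homog F _) hh.
  - by rewrite mulmxBl -dt -mulmxA -mulmxBr.
  by exists h'; rewrite -Dh' addrC subrK.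
have all_h i : exists h, [/\ i = 0 -> h = 0,
    homog_mx (aug_deg F i) (aug_deg F i.+1) h &
    aug_diff F i *m (t i - h *m aug_diff F i) = 0].
  elim: i => [|i [h [_ hh th0]]].
    exists 0; rewrite t0 mul0mx subr0 mulmx0; split=> // r s m.
    by rewrite mxE mcoeff0 eqxx.
  have [h' [hh' Dt]] := step i h hh th0; exists h'; split=> //.
  by rewrite Dt addrK mulmxA aug_diffK mul0mx.
move=> i; have [h [h0 hh /(step _ _ hh) [h' [hh' Dt]]]] := all_h i.
by exists h, h'.
Qed.

(** Treats the two cases in the definition of [tensor_cycles] at once. *)
Lemma sub_tensor_cycles F i j m (u : 'M[k]_(m, grank F i)) :
  (u <= tensor_cycles F i j)%MS =
    (u <= tensor_part F i j)%MS &&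
    ((i == 0) || (u *m const_part (aug_diff F i) == 0)).
Proof.
case: i u => [|i] u; first by rewrite andbT.
by rewrite sub_capmx; congr (_ && _); apply/sub_kermxP/eqP.
Qed.

Lemma tensor_boundariesE F i j : tensor_boundaries F i j =
  deg_proj k (aug_deg F i.+2) j *m const_part (aug_diff F i.+1).
Proof. by []. Qed.

Lemma tensor_boundaries_sub_cycles F i j :
  (tensor_boundaries F i j <= tensor_cycles F i j)%MS.
Proof.
rewrite sub_tensor_cycles; apply/andP; split.
  rewrite [X in (X <= _)%MS](deg_proj_const j (aug_diff_homog F i.+1)).
  exact: submxMl.
rewrite /tensor_boundaries -mulmxA.
have := congr1 (@const_part _ _ _ _) (aug_diffK F i); rewrite const_partM.
by move=> E; rewrite [X in _ *m X]E /const_part map_mx0 mulmx0 eqxx orbT.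
Qed.

(** Tor is a homotopy invariant: with comparison maps [f] and [g] both ways,
    [f g - 1] is null-homotopic, and the homotopy sends cycles to
    boundaries. *)
Lemma tor_dim_le F F' i j : (tor_dim F i j <= tor_dim F' i j)%N.
Proof.
have [f [f0 hf df]] := comparison_map F F'.
have [g [g0 hg dg]] := comparison_map F' F.
pose t i := f i *m g i - 1%:M.
have [|||h [h' [h0 hh' Dt]]] := @null_homotopy F t _ _ _ i.
- by rewrite /t f0 g0 mulmx1 subrr.
- move=> m; apply: homog_addmx; first exact: homog_mulmx (hf m) (hg m).
  by apply: homog_oppmx; exact: homog_scalar1.
- by move=> m; rewrite /t mulmxBr mulmxBl mulmx1 mul1mx mulmxA df -!mulmxA dg.
pose cf := const_part (f i.+1); pose cg := const_part (g i.+1).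
have [ZP Zd] : (tensor_cycles F i j <= tensor_part F i j)%MS /\
    ((i == 0) || (tensor_cycles F i j *m const_part (aug_diff F i) == 0)).
  by apply/andP; rewrite -sub_tensor_cycles.
have ZPE : tensor_cycles F i j *m tensor_part F i j = tensor_cycles F i j.
  exact: sub_deg_proj ZP.
apply: (@subquotient_rank_le _ _ _ _ _ _ _ _ _ _ _ cf cg).
- rewrite sub_tensor_cycles; apply/andP; split.
    rewrite -ZPE -mulmxA [X in _ *m X](deg_proj_const j (hf i.+1)) mulmxA.
    exact: submxMl.
  case/orP: Zd => [->//|/eqP Zd].
  by rewrite -mulmxA -const_partM -df const_partM mulmxA Zd mul0mx eqxx orbT.
- exact: tensor_boundaries_sub_cycles.
- rewrite !tensor_boundariesE -mulmxA -const_partM dg const_partM mulmxA.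
  rewrite (deg_proj_const j (hg i.+2)) -mulmxA; exact: submxMl.
- have -> : cf *m cg - 1%:M =
      const_part (aug_diff F i) *m const_part h +
      const_part h' *m const_part (aug_diff F i.+1).
    rewrite -!const_partM -const_partD -Dt const_partD const_partM.
    by congr (_ + _); rewrite /const_part map_mxN map_mx1.
  rewrite mulmxDr mulmxA.
  have -> : tensor_cycles F i j *m const_part (aug_diff F i) *m const_part h = 0.
    case/orP: Zd => [/eqP/h0 ->|/eqP->]; last by rewrite mul0mx.
    by rewrite /const_part map_mx0 mulmx0.
  rewrite add0r mulmxA -ZPE -[_ *m _ *m const_part h']mulmxA.
  rewrite [X in _ *m X *m _](deg_proj_const j hh') -!mulmxA.
  by rewrite mulmxA; exact: submxMl.
Qed.

Lemma tor_dim_unique F F' i j : tor_dim F i j = tor_dim F' i j.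
Proof. by apply/eqP; rewrite eqn_leq !tor_dim_le. Qed.

Lemma graded_bettiE F i j : graded_betti I i j = tor_dim F i j.
Proof.
rewrite /graded_betti.
have ex_b : exists b, exists F', @tor_dim k n I F' i j = b.
  by exists (tor_dim F i j), F.
have [F' <-] := epsilon_spec (inhabits 0%N) _ ex_b.
exact: tor_dim_unique.
Qed.
End AugmentedResolution.

(** * The Taylor resolution *)

Section Taylor.
Local Open Scope ring_scope.
Variables (k : fieldType) (n q : nat) (m : 'I_q -> 'X_{1..n}).
Local Notation R := {mpoly k[n]}.
Implicit Types (A B C : {set 'I_q}) (e f : 'I_q).

Definition lcm_mon A : 'X_{1..n} := [multinom \max_(e in A) m e i | i < n].

Lemma lcm_mon_le A u : (lcm_mon A <= u)%MM = [forall e in A, (m e <= u)%MM].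
Proof.
apply/mnm_lepP/forall_inP => [le_Au e eA|le_mu i].
  apply/mnm_lepP => i; apply: leq_trans (le_Au i); rewrite mnmE.
  exact: (leq_bigmax_cond (F := fun e => m e i)).
by rewrite mnmE; apply/bigmax_leqP => e /le_mu/mnm_lepP.
Qed.

Lemma lcm_monS A B : A \subset B -> (lcm_mon A <= lcm_mon B)%MM.
Proof.
move=> /subsetP sAB; rewrite lcm_mon_le; apply/forall_inP => e /sAB eB.
by have := lepm_refl (lcm_mon B); rewrite lcm_mon_le => /forall_inP; apply.
Qed.

Lemma lcm_mon0 : lcm_mon set0 = 0%MM.
Proof. by apply/mnmP=> i; rewrite !mnmE big_set0. Qed.

Lemma lcm_mon1 e : lcm_mon [set e] = m e.
Proof. by apply/mnmP=> i; rewrite !mnmE big_set1. Qed.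

(** Incidence sign of the facet [B] of the simplex [e |: B]. *)
Definition face_sign e B : k := (-1) ^+ #|[set f in B | (f < e)%N]|.

Lemma face_sign_sq e B : face_sign e B * face_sign e B = 1.
Proof. by rewrite -expr2 sqrr_sign. Qed.

Lemma face_signU1 e f B : f \notin B -> face_sign e (f |: B) = (-1) ^+ (f < e)%N * face_sign e B.
Proof.
move=> fB; rewrite /face_sign -exprD; congr (_ ^+ _).
have [fe|ef] := boolP (f < e)%N.
  have -> : [set g in f |: B | (g < e)%N] = f |: [set g in B | (g < e)%N].
    by apply/setP=> g; rewrite !inE; have [->|] := eqVneq g f; rewrite ?fe.
  by rewrite cardsU1 !inE (negPf fB).
rewrite add0n; congr #|pred_of_set _|; apply/setP=> g; rewrite !inE.
by have [->|] := eqVneq g f; rewrite ?(negPf ef) ?andbF.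
Qed.

(** The two ways to remove [e] and [f] from [e |: (f |: B)] have opposite signs,
    as exactly one of [e < f] and [f < e] holds. *)
Lemma face_sign_anticomm e f B : e != f -> e \notin B -> f \notin B ->
  face_sign f (e |: B) * face_sign e B = - (face_sign e (f |: B) * face_sign f B).
Proof.
move=> ef eB fB; rewrite !face_signU1 // -!mulrA [face_sign f B * _]mulrC.
case: (ltngtP e f) ef => [||/val_inj ->]; last by rewrite eqxx.
  by rewrite expr1 expr0 mulN1r mul1r.
by rewrite expr1 expr0 mulN1r mul1r opprK.
Qed.

(** Entry of the Taylor differential from the basis vector [A] to the basis
    vector [B]. At most one [e] contributes; writing it as a sum handles the
    case where [B] is not a facet of [A], and lets sums over [A] be exchanged
    with it. *)
Definition taylor_entry A B : R :=
  \sum_(e | (e \notin B) && (A == e |: B)) face_sign e B *: 'X_[lcm_mon A - lcm_mon B].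

Lemma taylor_entry_neq0 A B : taylor_entry A B != 0 ->
  exists2 e, e \notin B & A = e |: B.
Proof.
move=> nz; have [e /andP[eB /eqP AE]|no] :=
    pickP [pred e | (e \notin B) && (A == e |: B)]; first by exists e.
by case/eqP: nz; rewrite /taylor_entry big_pred0.
Qed.

Lemma taylor_entryE e B : e \notin B ->
  taylor_entry (e |: B) B = face_sign e B *: 'X_[lcm_mon (e |: B) - lcm_mon B].
Proof.
move=> eB; rewrite /taylor_entry (big_pred1 e) // => f /=.
apply/andP/eqP => [[fB /eqP/setP/(_ f)]|->//].
by rewrite !inE eqxx (negPf fB) !orbF => /eqP.
Qed.

Lemma sum_taylor_entry (v : {set 'I_q} -> R) B :
  \sum_A v A * taylor_entry A B =
  \sum_(e | e \notin B)
     v (e |: B) * (face_sign e B *: 'X_[lcm_mon (e |: B) - lcm_mon B]).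
Proof.
under eq_bigr => A _ do rewrite /taylor_entry mulr_sumr.
rewrite (exchange_big_dep (fun e => e \notin B)) /=; last by move=> A e _ /andP[].
apply: eq_bigr => e eB; rewrite (big_pred1 (e |: B)) // => A /=.
by rewrite eB.
Qed.

(** Pairing [(e, f)] with [(f, e)] rather than comparing the sum with its
    opposite, so that characteristic 2 needs no separate treatment. *)
Lemma sum_antisymmetric (P : rel 'I_q) (F : 'I_q -> 'I_q -> R) :
  (forall e f, P e f -> [/\ e != f, P f e & F f e = - F e f]) ->
  \sum_e \sum_(f | P e f) F e f = 0.
Proof.
move=> PF; rewrite pair_big_dep /= (bigID (fun p : 'I_q * 'I_q => (p.1 < p.2)%N)) /=.
rewrite [X in _ + X](_ : _ =
  \sum_(p | P p.1 p.2 && (p.1 < p.2)%N) - F p.1 p.2) ?sumrN ?subrr //.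
rewrite (reindex_inj (h := fun p : 'I_q * 'I_q => (p.2, p.1))) /=; last by move=> [a b] [c d] [-> ->].
rewrite -sumrN; apply: eq_big => [[e f]|[e f] /andP[/PF[_ _ ->]]] /=; last by rewrite opprK.
apply/andP/andP => -[Pef]; have [ef Pfe _] := PF _ _ Pef.
  by rewrite -leqNgt leq_eqVlt => /orP[/eqP/val_inj fe|//]; rewrite fe eqxx in ef.
by rewrite -leqNgt => /ltnW.
Qed.

Lemma taylor_entry_comp A C : \sum_B taylor_entry A B * taylor_entry B C = 0.
Proof.
rewrite sum_taylor_entry big_mkcond /=.
pose P e f := [&& e \notin C, f \notin e |: C & A == f |: (e |: C)].
pose F e f : R := (face_sign f (e |: C) * face_sign e C) *: 'X_[lcm_mon A - lcm_mon C].
rewrite (_ : bigop _ _ _ = \sum_e \sum_(f | P e f) F e f).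
  apply: sum_antisymmetric => e f /and3P[eC]; rewrite !inE negb_or => /andP[fe fC] AE.
  split; first by rewrite eq_sym.
    by rewrite /P !inE fC negb_or eC eq_sym fe setUCA.
  by rewrite /F -scaleNr face_sign_anticomm.
apply: eq_bigr => e _; rewrite /P; case: ifP => eC /=; last by rewrite big_pred0.
rewrite /taylor_entry mulr_suml; apply: eq_bigr => f /andP[_ /eqP AE].
rewrite -scalerAl -scalerAr scalerA -mpolyXD /F; congr (_ *: 'X_[_]).
have /mnm_lepP le1 : (lcm_mon C <= lcm_mon (e |: C))%MM by apply/lcm_monS/subsetU1.
have /mnm_lepP le2 : (lcm_mon (e |: C) <= lcm_mon A)%MM by rewrite AE; apply/lcm_monS/subsetU1.
by apply/mnmP=> i; rewrite !mnmDE !mnmBE addnBA // subnK.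
Qed.

(** Coordinate at [A] of the component of [v] of multidegree [u], where the basis
    vector [A] has multidegree [lcm_mon A]. *)
Definition strand (u : 'X_{1..n}) (v : {set 'I_q} -> R) A : k :=
  if (lcm_mon A <= u)%MM then (v A)@_(u - lcm_mon A) else 0.

Lemma mcoeffM_monom (p : R) a b : (p * 'X_[b])@_a = if (b <= a)%MM then p@_(a - b) else 0.
Proof.
case: ifP => [ba|/negP nba]; first by rewrite -{1}(submK ba) addmC mcoeffMX.
apply/eqP; rewrite mcoeff_eq0 (perm_mem (msuppMX p b)).
apply/negP=> /mapP[c _ ac]; case: nba; rewrite ac.
by apply/mnm_lepP=> i; rewrite mnmDE leq_addr.
Qed.

(** The Taylor differential preserves the multidegree, and on each multigraded
    strand it is the boundary operator of a simplex. *)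
Lemma mcoeff_taylor (v : {set 'I_q} -> R) B a :
  (\sum_A v A * taylor_entry A B)@_a =
  \sum_(e | e \notin B) face_sign e B * strand (a + lcm_mon B) v (e |: B).
Proof.
rewrite sum_taylor_entry linear_sum /=; apply: eq_bigr => e eB.
rewrite -scalerAr mcoeffZ mcoeffM_monom; congr (_ * _); rewrite /strand.
have /mnm_lepP leB : (lcm_mon B <= lcm_mon (e |: B))%MM by apply/lcm_monS/subsetU1.
have -> : (lcm_mon (e |: B) - lcm_mon B <= a)%MM = (lcm_mon (e |: B) <= a + lcm_mon B)%MM.
  by apply/mnm_lepP/mnm_lepP => le i; have := le i; rewrite mnmDE mnmBE leq_subLR addnC.
case: ifP => // /mnm_lepP le; congr (_ @_ _); apply/mnmP=> i.
rewrite !mnmBE mnmDE subnBA //.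
Qed.

(** A full simplex is contractible by coning off a vertex [c]: the summand under
    [if] is the cone of [U], and its boundary is [U] when [U] is a cycle. *)
Lemma simplex_homotopy (c : 'I_q) (U : {set 'I_q} -> k) B :
  (forall C, \sum_(e | e \notin C) face_sign e C * U (e |: C) = 0) ->
  \sum_(e | e \notin B)
    face_sign e B * (if c \in e |: B then face_sign c ((e |: B) :\ c) * U ((e |: B) :\ c) else 0)
  = U B.
Proof.
move=> dU; have [cB|cB] := boolP (c \in B); last first.
  rewrite (bigD1 c) //= setU11 setU1K // mulrA face_sign_sq mul1r big1 ?addr0 // => e /andP[_ ec].
  by rewrite !inE (negPf cB) eq_sym (negPf ec) mulr0.
pose C := B :\ c; have cC : c \notin C by rewrite !inE eqxx.
have BE : B = c |: C by rewrite setD1K.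
have := dU C; rewrite (bigD1 c) //= -BE => /eqP; rewrite addrC addr_eq0 => /eqP dUC.
transitivity (- face_sign c C * \sum_(e | e \notin B) face_sign e C * U (e |: C)).
  rewrite mulr_sumr; apply: eq_bigr => e eB.
  have ec : e != c by apply: contraNneq eB => ->.
  have eC : e \notin C by rewrite !inE ec.
  have -> : (e |: B) :\ c = e |: C.
    by rewrite BE setUCA setU1K // in_setU1 negb_or eq_sym ec.
  (* Removing c and adding e anticommute; what remains is the boundary of U at
     C, without the term of e = c. *)
  rewrite in_setU1 cB orbT !mulrA [in LHS]BE; congr (_ * _).
  rewrite -[face_sign e (c |: C)]mulr1 -(face_sign_sq c C) mulrA.
  rewrite -(opprK (_ * _ * face_sign c C)) -mulNr -face_sign_anticomm // 1?eq_sym //.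
  by rewrite !mulNr mulrC !mulrA face_sign_sq mul1r mulrC.
have -> : \sum_(e | e \notin B) face_sign e C * U (e |: C) = - (face_sign c C * U B).
  rewrite -dUC; apply: eq_bigl => e; rewrite !inE negb_and negbK.
  by have [->|] := eqVneq e c; rewrite ?cB ?andbT //= ?andbF.
by rewrite mulrNN mulrA face_sign_sq mul1r.
Qed.

Lemma mcoeff_truncated (E : 'X_{1..n} -> k) d a :
  (\sum_(b : 'X_{1..n < d}) E b *: 'X_[b])@_a = if (mdeg a < d)%N then E a else 0.
Proof.
case: ifP => [|/negbT lt]; first exact: mcoeff_mpoly.
rewrite linear_sum big1 // => b _; rewrite /= mcoeffZ mcoeffX.
by case: eqP => [ba|]; rewrite ?mulr0 //; rewrite -ba bmdeg in lt.
Qed.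

(** In multidegree [a] the Taylor complex is supported on the full simplex of
    all [e] with [m e <= a]. If there is such an [e], the strand is contracted by
    coning off one that depends only on [a]; otherwise it is supported on the
    empty set, where [u] vanishes. The primitive [w] of the cycle [u] is assembled from the cones
    [W a] over all multidegrees [a]. *)
Lemma taylor_exact (u : {set 'I_q} -> R) : u set0 = 0 ->
  (forall B, \sum_A u A * taylor_entry A B = 0) ->
  exists w, forall B, \sum_A w A * taylor_entry A B = u B.
Proof.
move=> u0 du.
have dU a C : \sum_(e | e \notin C) face_sign e C * strand a u (e |: C) = 0.
  have [le|nle] := boolP (lcm_mon C <= a)%MM.
    by rewrite -[a](submK le) -mcoeff_taylor du mcoeff0.
  rewrite big1 // => e _; rewrite /strand ifN ?mulr0 //.
  by apply: contra nle; apply: lepm_trans; apply/lcm_monS/subsetU1.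
pose W a A : k := if [pick e | (m e <= a)%MM] is Some c then
  if c \in A then face_sign c (A :\ c) * strand a u (A :\ c) else 0 else 0.
(* Coning enlarges the lcm and so lowers the degree of the coefficient: a
   degree bound for u is also one for w. *)
pose d := (\max_A msize (u A))%N.
pose w A : R := \sum_(b : 'X_{1..n < d}) W (b + lcm_mon A)%MM A *: 'X_[b].
have coef_w A b : (w A)@_b = if (mdeg b < d)%N then W (b + lcm_mon A)%MM A else 0.
  exact: (mcoeff_truncated (fun b => W (b + lcm_mon A)%MM A)).
have strand_w a A : strand a w A = W a A.
  have [W0|Wn0] := eqVneq (W a A) 0.
    rewrite /strand; case: ifP => // le; rewrite coef_w submK //.
    by rewrite W0 if_same.
  have : (lcm_mon A <= a)%MM && (mdeg (a - lcm_mon A) < d)%N.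
    move: Wn0; rewrite /W; case: pickP => [c mc|]; last by rewrite eqxx.
    case: ifP => [cA|]; last by rewrite eqxx.
    rewrite mulf_eq0 negb_or => /andP[_]; rewrite /strand.
    case: ifP => [le nz|]; last by rewrite eqxx.
    have -> : (lcm_mon A <= a)%MM.
      move: le; rewrite !lcm_mon_le => /forall_inP le; apply/forall_inP => e eA.
      by have [->//|ec] := eqVneq e c; apply: le; rewrite !inE ec.
    rewrite -mcoeff_msupp in nz.
    apply: leq_ltn_trans (leq_trans (msize_mdeg_lt nz) (leq_bigmax (A :\ c))).
    rewrite !mdegE; apply: leq_sum => i _; rewrite !mnmBE leq_sub2l //.
    by apply/mnm_lepP/lcm_monS/subD1set.
  by case/andP=> le lt; rewrite /strand le coef_w lt submK.
exists w => B; apply/mpolyP=> a; rewrite mcoeff_taylor.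
under eq_bigr => e _ do rewrite strand_w.
have -> : (u B)@_a = strand (a + lcm_mon B) u B.
  rewrite /strand addmK ifT //; apply/mnm_lepP=> i; rewrite mnmDE; exact: leq_addl.
rewrite /W; case: pickP => [c mc|no]; first exact/simplex_homotopy/dU.
rewrite big1 ?mulr0 => [|e _]; last by rewrite mulr0.
have [->|[e eB]] := set_0Vmem B; first by rewrite /strand u0 mcoeff0 if_same.
rewrite /strand ifN //; apply/negP; rewrite lcm_mon_le => /forall_inP/(_ e eB).
by rewrite no.
Qed.

Definition taylor_rank i := #|[set A : {set 'I_q} | #|A| == i]|.
Definition taylor_set i (r : 'I_(taylor_rank i)) : {set 'I_q} := enum_val r.

Lemma card_taylor_set i (r : 'I_(taylor_rank i)) : #|taylor_set r| = i.
Proof. by have := enum_valP r; rewrite inE => /eqP. Qed.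

Lemma taylor_setP i A : #|A| = i -> exists r : 'I_(taylor_rank i), taylor_set r = A.
Proof.
move=> Ai; have Ain : A \in [set A : {set 'I_q} | #|A| == i] by rewrite inE Ai.
by exists (enum_rank_in Ain A); rewrite /taylor_set enum_rankK_in.
Qed.

Lemma sum_taylor_set i (F : {set 'I_q} -> R) :
  (forall A, #|A| != i -> F A = 0) -> \sum_(r < taylor_rank i) F (taylor_set r) = \sum_A F A.
Proof.
move=> F0; rewrite [RHS](bigID (mem [set A : {set 'I_q} | #|A| == i])) /=.
rewrite [X in _ + X]big1 ?addr0 => [|A]; last by rewrite inE => /F0.
by rewrite -big_enum_val.
Qed.

(** Row vectors in homological degree [i] are regarded as functions on all sets
    of generators, zero outside the sets of size [i]; this is the form in which
    [taylor_exact] applies to them. *)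
Lemma taylor_row_extend i (u : 'rV[R]_(taylor_rank i)) :
  exists2 v : {set 'I_q} -> R,
    forall r, v (taylor_set r) = u 0 r & forall A, #|A| != i -> v A = 0.
Proof.
exists (fun A => \sum_(r | taylor_set r == A) u 0 r) => [r|A Ai].
  by rewrite (big_pred1 r) // => s; rewrite (inj_eq enum_val_inj).
rewrite big_pred0 // => r; apply: contraNF Ai => /eqP <-.
by rewrite card_taylor_set.
Qed.

Lemma taylor_entry_card A B : #|A| != #|B|.+1 -> taylor_entry A B = 0.
Proof.
move=> neq; apply/eqP; apply: contraNT neq => /taylor_entry_neq0[e eB ->].
by rewrite cardsU1 eB.
Qed.

Definition taylor_diff i : 'M[R]_(taylor_rank i.+1, taylor_rank i) :=
  \matrix_(r, s) taylor_entry (taylor_set r) (taylor_set s).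

(** The kernel condition is expressed by sets [B] instead of a matrix so that it
    covers both the differentials and, with [B] empty, the augmentation. *)
Lemma taylor_diff_exact i (u : 'rV[R]_(taylor_rank i.+1)) :
  (forall B, #|B| = i -> \sum_r u 0 r * taylor_entry (taylor_set r) B = 0) <->
  exists w, u = w *m taylor_diff i.+1.
Proof.
split=> [du|[w ->] C Ci]; last first.
  under eq_bigr => s _ do rewrite mxE mulr_suml.
  rewrite exchange_big big1 //= => r _.
  under eq_bigr => s _ do rewrite mxE -mulrA.
  rewrite -mulr_sumr.
  rewrite (@sum_taylor_set i.+1 (fun B => taylor_entry (taylor_set r) B * taylor_entry B C)).
    by rewrite taylor_entry_comp mulr0.
  by move=> A Ai; rewrite [taylor_entry A C]taylor_entry_card ?mulr0 // Ci.
have [v vE v0] := taylor_row_extend u.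
have [|B|w Dw] := @taylor_exact v.
- by apply: v0; rewrite cards0.
- have [Bi|Bi] := eqVneq #|B| i.
    rewrite -(sum_taylor_set (i := i.+1)) => [|A /v0 ->]; last by rewrite mul0r.
    by rewrite -[RHS](du B Bi); apply: eq_bigr => r _; rewrite vE.
  rewrite big1 // => A _; have [Ai|/v0->] := eqVneq #|A| i.+1; last by rewrite mul0r.
  by rewrite taylor_entry_card ?mulr0 // Ai eqSS eq_sym.
exists (\row_r w (taylor_set r)); apply/rowP=> s; rewrite mxE -vE -Dw.
rewrite -(sum_taylor_set (i := i.+2)) => [|A Ai].
  by apply: eq_bigr => r _; rewrite !mxE.
by rewrite taylor_entry_card ?mulr0 // card_taylor_set.
Qed.

Lemma taylor_entry_homog A B a : (taylor_entry A B)@_a != 0 ->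
  (mdeg a + mdeg (lcm_mon B))%N = mdeg (lcm_mon A).
Proof.
have [->|/taylor_entry_neq0[e eB ->]] := eqVneq (taylor_entry A B) 0.
  by rewrite mcoeff0 eqxx.
rewrite taylor_entryE // mcoeffZ mcoeffX.
have [<- _|_] := eqVneq (_ - _)%MM a; last by rewrite mulr0 eqxx.
by rewrite -mdegD submK //; apply/lcm_monS/subsetU1.
Qed.

(** After tensoring with [k], only the facets with the same lcm remain. *)
Lemma const_taylor_entry e B : e \notin B ->
  (taylor_entry (e |: B) B)@_0 = face_sign e B * (lcm_mon (e |: B) == lcm_mon B)%:R.
Proof.
move=> eB; rewrite taylor_entryE // mcoeffZ mcoeffX; congr (_ * _%:R).
have le : (lcm_mon B <= lcm_mon (e |: B))%MM by apply/lcm_monS/subsetU1.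
congr nat_of_bool; apply/eqP/eqP => [d0|->]; first by rewrite -(submK le) d0 add0m.
by apply/mnmP=> i; rewrite mnmBE subnn mnm0E.
Qed.

Variable I : R -> Prop.
Hypothesis IE : forall p, I p <-> exists c : 'I_q -> R, p = \sum_e c e * 'X_[m e].

Definition taylor_deg i (r : 'I_(taylor_rank i)) := mdeg (lcm_mon (taylor_set r)).

Definition taylor_aug : 'cV[R]_(taylor_rank 1) := \col_r taylor_entry (taylor_set r) set0.

Lemma taylor_diff_homog i (r : 'I_(taylor_rank i.+2)) (s : 'I_(taylor_rank i.+1)) :
  if (taylor_deg s <= taylor_deg r)%N
  then taylor_diff i.+1 r s \is (taylor_deg r - taylor_deg s).-homog
  else taylor_diff i.+1 r s == 0.
Proof.
apply: homog_mx_sub => {}r {}s a; rewrite mxE; exact: taylor_entry_homog.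
Qed.

Lemma taylor_aug_homog r : taylor_aug r 0 \is (taylor_deg r).-homog.
Proof.
apply/dhomogP => a; rewrite mcoeff_msupp mxE => /taylor_entry_homog.
by rewrite lcm_mon0 mdeg0 addn0.
Qed.

Lemma taylor_aug_image p : I p <-> exists u : 'rV[R]_(taylor_rank 1), p = (u *m taylor_aug) 0 0.
Proof.
have E1 e : taylor_entry [set e] set0 = 'X_[m e].
  rewrite -[[set e]]setU0 taylor_entryE ?inE // setU0 lcm_mon1 lcm_mon0 subm0.
  by rewrite /face_sign setIdE set0I cards0 expr0 scale1r.
have sumE (v : {set 'I_q} -> R) : \sum_r v (taylor_set r) * taylor_aug r 0 =
    \sum_e v [set e] * 'X_[m e].
  under eq_bigr => r _ do rewrite mxE.
  rewrite (@sum_taylor_set 1 (fun A => v A * taylor_entry A set0)) => [|A Ai]; last first.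
    by rewrite taylor_entry_card ?mulr0 // cards0.
  rewrite sum_taylor_entry; apply: eq_big => [e|e _]; first by rewrite inE.
  by rewrite -taylor_entryE ?inE // setU0 E1.
split=> [/IE[c ->]|[u ->]]; last first.
  apply/IE.
  have [v vE _] := taylor_row_extend u.
  exists (fun e => v [set e]); rewrite -sumE mxE.
  by apply: eq_bigr => r _; rewrite vE.
exists (\row_r \sum_(e in taylor_set r) c e); rewrite mxE.
under [RHS]eq_bigr => r _ do rewrite mxE.
rewrite (sumE (fun A => \sum_(e in A) c e)).
by apply: eq_bigr => e _; rewrite big_set1.
Qed.

Lemma taylor_aug_exact (u : 'rV[R]_(taylor_rank 1)) :
  u *m taylor_aug = 0 <-> exists w, u = w *m taylor_diff 1.
Proof.
rewrite -taylor_diff_exact; split=> [/matrixP/(_ 0 0) du B|du].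
  move/eqP; rewrite cards_eq0 => /eqP->; move: du; rewrite !mxE => du.
  by rewrite -[RHS]du; apply: eq_bigr => r _; rewrite !mxE.
apply/matrixP=> a b; rewrite !ord1 !mxE -[RHS](du set0 (cards0 _)).
by apply: eq_bigr => r _; rewrite !mxE.
Qed.

Lemma taylor_complex_exact i (u : 'rV[R]_(taylor_rank i.+2)) :
  u *m taylor_diff i.+1 = 0 <-> exists w, u = w *m taylor_diff i.+2.
Proof.
rewrite -taylor_diff_exact; split=> [/matrixP du B Bi|du].
  have [s <-] := taylor_setP Bi; have := du 0 s; rewrite !mxE => {}du.
  by rewrite -[RHS]du; apply: eq_bigr => r _; rewrite !mxE.
apply/matrixP=> a s; rewrite !ord1 !mxE -[RHS](du _ (card_taylor_set s)).
by apply: eq_bigr => r _; rewrite !mxE.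
Qed.

Definition taylor_resolution : graded_free_resolution I :=
  GradedFreeResolution taylor_diff_homog taylor_aug_homog taylor_aug_image
    taylor_aug_exact taylor_complex_exact.

End Taylor.

(** * Sets of edges in a forest *)

Section Forests.
Variables (T : finType) (G : simple_graph T).
Implicit Types (A B : {set {set T}}) (W : {set T}).

Lemma edgesP e : reflect (exists x y, G x y /\ e = [set x; y]) (e \in edges G).
Proof.
apply: (iffP imsetP) => [[[x y]] | [x [y [Gxy ->]]]]; last first.
  by exists (x, y); rewrite ?inE.
by rewrite inE /= => Gxy ->; exists x, y.
Qed.

Lemma adj_neq x y : G x y -> x != y.
Proof. by apply: contraTneq => ->; rewrite adj_irrefl. Qed.

Lemma card_edge e : e \in edges G -> #|e| = 2.
Proof. by case/edgesP=> x [y [/adj_neq xy ->]]; rewrite cards2 xy. Qed.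

Lemma edge_end e x : e \in edges G -> x \in e -> exists2 y, G x y & e = [set x; y].
Proof.
case/edgesP=> a [b [Gab ->]]; rewrite !inE => /orP[]/eqP ->; first by exists b.
by exists a; rewrite 1?adj_sym // setUC.
Qed.

(** The default value [x0] is never reached, as both indices are bounded by the
    size of [s]. *)
Definition induced_path x0 s :=
  uniq s /\ forall i j, i < j < size s -> G (nth x0 s i) (nth x0 s j) = (j == i.+1).

Lemma induced_path_cons x0 w s : induced_path x0 s -> w \notin s ->
  (forall j, j < size s -> G w (nth x0 s j) = (j == 0)) -> induced_path x0 (w :: s).
Proof.
move=> [us ps] ws Gw; split=> /=; first by rewrite ws.
by case=> [|i] [|j] //=; rewrite !ltnS => ij; [exact: Gw | exact: ps].
Qed.

(** As [j] is the first position after 0 with a neighbour of [w], the cycle has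
    no chord at [w], and it has no other chord because the path is induced. *)
Lemma induced_cycle_close x0 w s j : induced_path x0 s -> w \notin s ->
  0 < j < size s -> G w (nth x0 s 0) -> G w (nth x0 s j) ->
  (forall i, 0 < i < j -> ~~ G w (nth x0 s i)) ->
  induced_cycle G (w :: take j.+1 s).
Proof.
move=> [us ps] ws /andP[j0 js] Gw0 Gwj min_j.
pose c := w :: take j.+1 s; rewrite -/c.
have size_t : size (take j.+1 s) = j.+1 by rewrite size_takel.
have size_c : size c = j.+2 by rewrite /= size_t.
have uc : uniq c.
  by rewrite /= take_uniq // andbT; apply: contra ws; apply: mem_take.
have cS i : i <= j -> nth x0 c i.+1 = nth x0 s i by move=> ij; rewrite /= nth_take.
(* Cyclic successor on the positions 0, .., j + 1 of c. *)
pose nx a := if a < j.+1 then a.+1 else 0.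
have nextE a : a < j.+2 -> next c (nth x0 c a) = nth x0 c (nx a).
  move=> aj; rewrite next_nth mem_nth ?size_c // {1}/c index_uniq ?size_c //.
  rewrite /nx; case: ltnP => [lt|ge]; first by apply: set_nth_default; rewrite size_t.
  by rewrite nth_default // size_t.
have adj_c a b : a < b < j.+2 ->
    G (nth x0 c a) (nth x0 c b) = (b == nx a) || (a == nx b).
  case/andP=> ab bj; rewrite ltnS in bj; rewrite /nx (leq_trans ab bj).
  case: b ab bj => // b ab bj; rewrite ltnS in bj; rewrite cS // ltnS.
  case: a ab => [|a] ab.
    rewrite /= eqSS; case: (ltngtP b j) bj => // [bj|-> _]; last by rewrite Gwj orbT.
    rewrite orbF; case: b bj {ab} => [|b] bj; first by rewrite Gw0.
    by rewrite (negPf (min_j _ _)).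
  rewrite ltnS in ab; rewrite cS; last exact: ltnW (leq_trans ab bj).
  rewrite ps; last by rewrite ab (leq_ltn_trans bj).
  rewrite !eqSS; case: ltnP => _; rewrite ?orbF // eqSS.
  by rewrite [a == _]ltn_eqF ?orbF // ltnW.
split=> //; first by rewrite size_c.
move=> x y xc yc.
have [a aj <-] := nthP x0 xc; have [b bj <-] := nthP x0 yc.
rewrite size_c in aj bj; rewrite !nextE //.
have nxj t : nx t < j.+2 by rewrite /nx; case: ifP.
rewrite !nth_uniq ?size_c //.
case: (ltngtP a b) => [ab|ba|->]; first by rewrite adj_c ?ab.
  by rewrite adj_sym orbC adj_c ?ba.
rewrite adj_irrefl orbb /nx; case: ltnP => [_|]; first by rewrite ltn_eqF.
by case: b bj.
Qed.

(** Otherwise an induced path in [W] could be extended forever: its first vertex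
    has a second neighbour [w] in [W], which lies outside the path, and [w] is
    joined to no other vertex of the path, since that would close an induced
    cycle. *)
Lemma forest_leaf W : is_forest G -> W != set0 ->
  exists2 v, v \in W & #|[set w in W | G v w]| <= 1.
Proof.
move=> forestG /set0Pn[x0 x0W].
have [v /andP[vW leaf]|no_leaf] := pickP [pred v in W | #|[set w in W | G v w]| <= 1].
  by exists v.
have long l : exists2 s, induced_path x0 s & size s = l.+1 /\ {subset s <= W}.
  elim: l => [|l [[|v s] pvs [ss sW]]] //.
    exists [:: x0]; first by split=> // i [|j] //=; rewrite andbF.
    by split=> // x; rewrite inE => /eqP->.
  have [us ps] := pvs; have vW : v \in W by apply: sW; rewrite mem_head.
  have := no_leaf v; rewrite /= vW => /negbT; rewrite -ltnNge => deg_v.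
  have [w] : exists w, w \in [set w in W | G v w] :\ nth x0 (v :: s) 1.
    by apply/card_gt0P; rewrite -ltnS; apply: leq_trans deg_v _;
    rewrite (cardsD1 (nth x0 (v :: s) 1)); exact: leq_add (leq_b1 _) (leqnn _).
  rewrite !inE => /and3P[w1 wW Gvw].
  have ws : w \notin v :: s.
    apply/negP=> /(nthP x0)[[|i] is_ Dw]; first by rewrite -Dw adj_irrefl in Gvw.
    by have := ps 0 i.+1 is_; rewrite Dw Gvw => /esym/eqP[i0]; rewrite -Dw i0 eqxx in w1.
  have [/existsP[j0 /andP[j0_gt0 Gwj0]]|none] :=
      boolP [exists j : 'I_(size (v :: s)), (0 < j) && G w (nth x0 (v :: s) j)].
    have ex_j : exists j, [&& 0 < j, j < size (v :: s) & G w (nth x0 (v :: s) j)].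
      by exists j0; rewrite j0_gt0 ltn_ord.
    case: (ex_minnP ex_j) => j /and3P[j_gt0 js Gwj] min_j.
    case: (forestG (w :: take j.+1 (v :: s))).
    apply: (@induced_cycle_close x0) => //; first by rewrite j_gt0.
      by rewrite /= adj_sym.
    move=> i /andP[i0 ij]; apply/negP=> Gwi; have := min_j i.
    by rewrite i0 Gwi andbT (ltn_trans ij js) leqNgt ij => /(_ isT).
  exists (w :: v :: s).
    apply: induced_path_cons => // -[_|j js]; first by rewrite /= adj_sym.
    apply/negbTE; apply: contra none => Gwj.
    by apply/existsP; exists (Ordinal js).
  by split; [rewrite /= -ss | move=> x; rewrite inE => /predU1P[->//|/sW]].
have [s [us _] [ss _]] := long #|T|.
by have := max_card (mem s); rewrite (card_uniqP us) ss ltnn.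
Qed.

Lemma coverP A x : reflect (exists2 e, e \in A & x \in e) (x \in cover A).
Proof. exact: bigcupP. Qed.

(** Induction by removal of an edge that has an end [v] of degree 1 in the graph
    induced on the covered vertices: [v] is then no longer covered. *)
Lemma forest_card_cover A : is_forest G -> A \subset edges G -> A != set0 ->
  #|A| < #|cover A|.
Proof.
move=> forestG; have [l] := ubnP #|A|; elim: l A => // l IH A lt_Al sAE A0.
have cA0 : cover A != set0.
  case/set0Pn: A0 => e eA; have /card_edge e2 := subsetP sAE e eA.
  have /card_gt0P[x xe] : 0 < #|e| by rewrite e2.
  by apply/set0Pn; exists x; apply/coverP; exists e.
have [v vW leaf] := forest_leaf forestG cA0.
have [e eA ve] := coverP _ _ vW.
have other f : f \in A -> v \in f -> f = e.
  move=> fA vf; have [y Gvy De] := edge_end (subsetP sAE e eA) ve.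
  have [z Gvz Df] := edge_end (subsetP sAE f fA) vf.
  rewrite De Df; congr [set v; _]; apply: (card_le1_eqP leaf); rewrite inE ?Gvy ?Gvz andbT.
    by apply/coverP; exists e; rewrite // De !inE eqxx orbT.
  by apply/coverP; exists f; rewrite // Df !inE eqxx orbT.
have sub : cover (A :\ e) \subset cover A :\ v.
  apply/subsetP=> x /coverP[f /setD1P[fe fA] xf].
  rewrite in_setD1; apply/andP; split; last by apply/coverP; exists f.
  by apply: contraNneq fe => xv; apply/eqP/other => //; rewrite -xv.
rewrite (cardsD1 e) eA (cardsD1 v (cover A)) vW !add1n ltnS.
have [A'0|A'0] := eqVneq (A :\ e) set0.
  have [y Gvy De] := edge_end (subsetP sAE e eA) ve.
  rewrite A'0 cards0; apply/card_gt0P; exists y; rewrite in_setD1.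
  rewrite eq_sym adj_neq //=; apply/coverP; exists e => //.
  by rewrite De !inE eqxx orbT.
apply: leq_trans (subset_leq_card sub); apply: IH => //.
  by move: lt_Al; rewrite (cardsD1 e) eA add1n ltnS.
exact: subset_trans (subD1set _ _) sAE.
Qed.

(** The union of [A] and [B] covers no more vertices than [A], hence cannot have
    more edges either. *)
Lemma forest_cover_inj A B : is_forest G -> A \subset edges G -> B \subset edges G ->
  A != set0 -> #|cover A| = #|A|.+1 -> #|B| = #|A| -> cover B = cover A -> B = A.
Proof.
move=> forestG sA sB A0 cA cardB cB.
have cAB : cover (A :|: B) = cover A.
  by rewrite /cover bigcup_setU -/(cover A) -/(cover B) cB setUid.
have AB0 : A :|: B != set0 by rewrite setU_eq0 negb_and A0.
have : #|A :|: B| <= #|A|.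
  by rewrite -ltnS -cA -cAB forest_card_cover // subUset sA.
move=> le; have /eqP AAB : A == A :|: B by rewrite eqEcard subsetUl.
by apply/eqP; rewrite eqEcard cardB leqnn andbT AAB subsetUr.
Qed.

Definition star A := [exists v, [forall e in A, v \in e]].

Lemma starP A : reflect (exists v, {in A, forall e : {set T}, v \in e}) (star A).
Proof. by apply: (iffP existsP) => -[v vA]; exists v; apply/forall_inP. Qed.

Lemma star_edgeE A v e : A \subset edges G -> {in A, forall e : {set T}, v \in e} ->
  e \in A -> exists2 y, v != y & e = [set v; y].
Proof.
move=> sA vA eA; have [y /adj_neq vy ->] := edge_end (subsetP sA e eA) (vA e eA).
by exists y.
Qed.

(** The edges of a star correspond to the covered vertices other than its
    centre. *)
Lemma star_card_cover A : A \subset edges G -> A != set0 -> star A ->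
  #|cover A| = #|A|.+1.
Proof.
move=> sA /set0Pn[e0 e0A] /starP[v vA].
have vc : v \in cover A by apply/coverP; exists e0; rewrite ?vA.
rewrite (cardsD1 v) vc add1n; congr _.+1.
rewrite -(@card_in_imset _ _ (fun y => [set v; y])); last first.
  move=> y z; rewrite !in_setD1 => /andP[yv _] _ /setP/(_ y).
  by rewrite !inE eqxx orbT (negPf yv) => /esym/eqP.
congr #|pred_of_set _|; apply/setP=> e; apply/imsetP/idP => [[y]|eA].
  rewrite in_setD1 => /andP[yv /coverP[f fA yf]] ->.
  have [z _ Df] := star_edgeE sA vA fA; move: yf fA.
  by rewrite Df !inE (negPf yv) => /eqP ->.
have [y vy De] := star_edgeE sA vA eA; exists y => //.
rewrite in_setD1 eq_sym vy; apply/coverP; exists e => //.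
by rewrite De !inE eqxx orbT.
Qed.

Lemma star_irredundant A e : A \subset edges G -> star A -> 1 < #|A| -> e \in A ->
  cover (A :\ e) != cover A.
Proof.
move=> sA /starP[v vA] A2 eA; have [y vy De] := star_edgeE sA vA eA.
have yc : y \in cover A by apply/coverP; exists e; rewrite // De !inE eqxx orbT.
apply: contraTneq yc => <-; apply/negP=> /coverP[f /setD1P[fe fA] yf].
have [z _ Df] := star_edgeE sA vA fA; case/eqP: fe; move: yf.
by rewrite De Df !inE eq_sym (negPf vy) /= => /eqP->.
Qed.

(** Every edge [e] of [A] has an end [p e] that no other edge contains. These
    private ends are distinct, so exactly one covered vertex is not private, and
    the second end of each edge, which cannot be private to another edge, has to
    be that vertex. *)
Lemma irredundant_star A : A \subset edges G -> #|cover A| = #|A|.+1 ->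
  {in A, forall e, cover (A :\ e) != cover A} -> star A.
Proof.
move=> sA cA irrA.
have private e : exists x, e \in A -> x \in e /\ {in A, forall f : {set T}, x \in f -> f = e}.
  have [eA|] := boolP (e \in A); last first.
    by have /card_gt0P[x _] : 0 < #|cover A| by [rewrite cA]; exists x.
  have : ~~ (cover A \subset cover (A :\ e)).
    apply: contra (irrA e eA) => sub; rewrite eqEsubset sub andbT.
    apply/subsetP=> x /coverP[f /setD1P[_ fA] xf].
    by apply/coverP; exists f.
  case/subsetPn=> x /coverP[g gA xg] nx; exists x => _.
  have only f : f \in A -> x \in f -> f = e.
    move=> fA xf; apply/eqP; apply: contraNT nx => fe.
    by apply/coverP; exists f; rewrite // in_setD1 fe.
  by split=> //; rewrite -(only g).
have [p pP] := fin_all_exists private.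
have p_inj : {in A &, injective p}.
  move=> e f eA fA pef; have [_ only] := pP f fA; apply: only => //.
  by rewrite -pef; have [] := pP e eA.
have : #|cover A :\: p @: A| == 1.
  rewrite cardsD (setIidPr _) ?card_in_imset ?cA ?subSnn //.
  apply/subsetP=> _ /imsetP[e eA ->]; apply/coverP; exists e => //.
  by have [] := pP e eA.
case/cards1P=> v Dv; apply/starP; exists v => e eA; have [pe _] := pP e eA.
have [y py De] := edge_end (subsetP sA e eA) pe.
have ye : y \in e by rewrite De !inE eqxx orbT.
suff : y \in cover A :\: p @: A by rewrite Dv inE => /eqP <-.
rewrite inE; apply/andP; split; last by apply/coverP; exists e.
apply/imsetP=> -[f fA yf]; have [_ only] := pP f fA.
have ef : e = f by apply: only; rewrite -?yf.
by move: (adj_neq py); rewrite yf ef eqxx.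
Qed.

(** An edge is determined by its two ends. *)
Lemma star_center_unique A v w : A \subset edges G -> 1 < #|A| ->
  {in A, forall e : {set T}, v \in e} -> {in A, forall e : {set T}, w \in e} -> v = w.
Proof.
move=> sA A2 vA wA; apply/eqP; apply: contraLR A2 => vw; rewrite -leqNgt.
apply/card_le1_eqP => e f eA fA.
suff all_vw g : g \in A -> g = [set v; w] by rewrite (all_vw e eA) (all_vw f fA).
move=> gA; apply/esym/eqP; rewrite eqEcard (card_edge (subsetP sA g gA)) cards2 vw andbT.
by apply/subsetP=> x; rewrite !inE => /orP[]/eqP->; [apply: vA | apply: wA].
Qed.

Lemma card_stars i : 0 < i ->
  #|[set A : {set {set T}} | [&& A \subset edges G, #|A| == i.+1 & star A]]| =
  \sum_v 'C(degree G v, i.+1).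
Proof.
move=> i0; under [RHS]eq_bigr => v _ do rewrite /degree -cards_draws -sum1_card.
rewrite -sum1_card (exchange_big_dep predT) //= big_mkcond /=.
apply: eq_bigr => A _; rewrite inE; case: ifP => [/and3P[sA /eqP cA /starP[v vA]]|no].
  rewrite (big_pred1 v) // => w; rewrite inE cA eqxx andbT.
  apply/subsetP/eqP => [wA|-> e eA]; last by rewrite inE (subsetP sA) // vA.
  apply: (@star_center_unique A) => //; first by rewrite cA.
  by move=> e /wA; rewrite inE => /andP[].
rewrite big_pred0 // => v; apply/negP; rewrite inE => /andP[/subsetP sub cA].
case/negP: no; rewrite cA /=; apply/andP; split.
  by apply/subsetP=> e /sub; rewrite inE => /andP[].
by apply/starP; exists v => e /sub; rewrite inE => /andP[].
Qed.

End Forests.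

(** * The linear strand of the edge ideal of a forest *)

Section EdgeIdeal.
Local Open Scope ring_scope.
Variables (k : fieldType) (n : nat) (G : simple_graph 'I_n).
Local Notation R := {mpoly k[n]}.
Local Notation q := #|edges G|.
Implicit Types (A B : {set 'I_q}).

Definition edge_of (e : 'I_q) : {set 'I_n} := enum_val e.

Lemma edge_ofP e : edge_of e \in edges G. Proof. exact: enum_valP. Qed.

Lemma edge_of_inj : injective edge_of. Proof. exact: enum_val_inj. Qed.

Lemma edge_of_surj f : f \in edges G -> exists e, edge_of e = f.
Proof. by move=> fE; exists (enum_rank_in fE f); rewrite /edge_of enum_rankK_in. Qed.

Definition edge_mon (e : 'I_q) : 'X_{1..n} := [multinom (i \in edge_of e : nat) | i < n].

Lemma edge_mon_pair e x y : G x y -> edge_of e = [set x; y] ->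
  'X_[edge_mon e] = 'X_x * 'X_y :> R.
Proof.
move=> /adj_neq xy De; rewrite -mpolyXD; congr 'X_[_]; apply/mnmP=> i.
rewrite mnmDE !mnmE De !inE [i == x]eq_sym [i == y]eq_sym.
by case: (x =P i) xy => [->|_]; case: (y =P i) => [->|_] //; rewrite eqxx.
Qed.

Lemma edge_idealP (p : R) : edge_ideal k G p <->
  exists c : 'I_q -> R, p = \sum_e c e * 'X_[edge_mon e].
Proof.
split=> [[l [c [g [gG ->]]]]|[c ->]]; last first.
  exists q, c, (fun e => 'X_[edge_mon e]); split=> // e.
  have /edgesP[x [y [Gxy De]]] := edge_ofP e.
  by exists x, y; split=> //; apply: edge_mon_pair.
have /fin_all_exists[h gh] a : exists e, g a = 'X_[edge_mon e].
  have [x [y [Gxy ->]]] := gG a.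
  have [|e De] := @edge_of_surj [set x; y]; first by apply/edgesP; exists x, y.
  by exists e; rewrite (edge_mon_pair Gxy De).
exists (fun e => \sum_(a | h a == e) c a).
rewrite (partition_big h predT) //=; apply: eq_bigr => e _.
by rewrite mulr_suml; apply: eq_bigr => a /eqP <-; rewrite gh.
Qed.

Definition edge_resolution : graded_free_resolution (edge_ideal k G) :=
  taylor_resolution edge_idealP.

Definition edge_sets A : {set {set 'I_n}} := edge_of @: A.

Lemma card_edge_sets A : #|edge_sets A| = #|A|.
Proof. exact: card_imset edge_of_inj. Qed.

Lemma edge_sets_sub A : edge_sets A \subset edges G.
Proof. by apply/subsetP=> _ /imsetP[e _ ->]; apply: edge_ofP. Qed.

Lemma edge_setsD1 A e : edge_sets (A :\ e) = edge_sets A :\ edge_of e.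
Proof.
apply/setP=> f; apply/imsetP/setD1P => [[g /setD1P[ge gA] ->]|[fe /imsetP[g gA Df]]].
  by rewrite (inj_eq edge_of_inj) ge imset_f.
by exists g; rewrite // in_setD1 gA andbT; apply: contraNneq fe => <-; rewrite Df.
Qed.

(** Edge monomials are squarefree, so the lcm over [A] is the product of the
    vertices covered by [A]. *)
Lemma lcm_edge_mon A i : lcm_mon edge_mon A i = (i \in cover (edge_sets A)) :> nat.
Proof.
rewrite mnmE; apply/eqP; rewrite eqn_leq; apply/andP; split.
  apply/bigmax_leqP => e eA; rewrite mnmE; case: (boolP (i \in edge_of e)) => // ie.
  by rewrite (_ : i \in _) //; apply/coverP; exists (edge_of e); rewrite ?imset_f.
case: coverP => // -[_ /imsetP[e eA ->] ie].
by apply: leq_trans (leq_bigmax_cond _ eA); rewrite mnmE ie.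
Qed.

Lemma mdeg_lcm_edge A : mdeg (lcm_mon edge_mon A) = #|cover (edge_sets A)|.
Proof.
rewrite mdegE -[RHS]sum1_card [RHS]big_mkcond /=; apply: eq_bigr => i _.
by rewrite lcm_edge_mon; case: (_ \in _).
Qed.

Lemma lcm_edge_eq A B : (lcm_mon edge_mon A == lcm_mon edge_mon B) =
  (cover (edge_sets A) == cover (edge_sets B)).
Proof.
apply/eqP/eqP => [/mnmP E|E]; last by apply/mnmP=> i; rewrite !lcm_edge_mon E.
apply/setP=> i; have := E i; rewrite !lcm_edge_mon.
by do 2!case: (_ \in _).
Qed.

Hypothesis forestG : is_forest G.

Lemma edge_sets_neq0 A i : #|A| = i.+1 -> edge_sets A != set0.
Proof. by move=> Ai; rewrite -card_gt0 card_edge_sets Ai. Qed.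

Lemma mdeg_lcm_forest i (r : 'I_(taylor_rank q i.+1)) :
  (i.+1 < mdeg (lcm_mon edge_mon (taylor_set r)))%N.
Proof.
rewrite mdeg_lcm_edge -{1}(card_taylor_set r) -card_edge_sets.
apply: forest_card_cover => //; first exact: edge_sets_sub.
exact: edge_sets_neq0 (card_taylor_set r).
Qed.

(** Sets of [i + 2] edges cover at least [i + 3] vertices, so the Taylor complex
    has no basis vector of degree [i + 2] in homological degree [i + 1]. *)
Lemma linear_strand_boundaries i : tensor_boundaries edge_resolution i (i + 2) = 0.
Proof.
rewrite tensor_boundariesE; set P := deg_proj _ _ _.
suff -> : P = 0 by rewrite mul0mx.
apply/matrixP=> r s; rewrite !mxE.
have := mdeg_lcm_forest r.
by rewrite addn2 /= /taylor_deg; case: ltngtP => //; rewrite mul0rn.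
Qed.

Lemma rank_tensor_part i :
  \rank (tensor_part edge_resolution i (i + 2)) =
  #|[pred r : 'I_(taylor_rank q i.+1) |
      #|cover (edge_sets (taylor_set r))| == (i + 2)%N]|.
Proof.
rewrite -(mxrank_diag_pred k); congr (\rank (diag_mx _)).
by apply/rowP=> r; rewrite !mxE /= /taylor_deg mdeg_lcm_edge.
Qed.

Definition star_index i : pred 'I_(taylor_rank q i) :=
  fun r => star (edge_sets (taylor_set r)).

Lemma star_index_irredundant i (r : 'I_(taylor_rank q i.+2)) e :
  star_index r -> e \in taylor_set r ->
  cover (edge_sets (taylor_set r :\ e)) != cover (edge_sets (taylor_set r)).
Proof.
move=> st er; rewrite edge_setsD1; apply: star_irredundant => //.
- exact: edge_sets_sub.
- by rewrite card_edge_sets card_taylor_set.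
- exact: imset_f.
Qed.

(** The cycles are the span of the basis vectors indexed by stars. A star is a
    cycle because its lcm drops with every edge. Conversely, if the set of index
    [r] has an edge [e] whose removal keeps the covered vertices, then [r] is the
    only index of the right degree whose boundary involves the set without [e],
    so a cycle vanishes at [r]. *)
Lemma rank_linear_strand_cycles i : \rank (tensor_cycles edge_resolution i.+1 (i.+1 + 2)) =
  #|star_index (i := i.+2)|.
Proof.
rewrite -(mxrank_diag_pred k); set S := diag_mx _; set Z := tensor_cycles _ _ _.
have degE (r : 'I_(taylor_rank q i.+2)) :
    (taylor_deg edge_mon r == i.+1 + 2)%N =
    (#|cover (edge_sets (taylor_set r))| == #|edge_sets (taylor_set r)|.+1).
  by rewrite /taylor_deg mdeg_lcm_edge card_edge_sets card_taylor_set addn2.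
have ne0 (r : 'I_(taylor_rank q i.+2)) : edge_sets (taylor_set r) != set0.
  exact: edge_sets_neq0 (card_taylor_set r).
have star_deg (r : 'I_(taylor_rank q i.+2)) : star_index r ->
    (taylor_deg edge_mon r == i.+1 + 2)%N.
  by move=> st; rewrite degE (@star_card_cover _ G) // edge_sets_sub.
have [ZP /eqP Zd] : (Z <= tensor_part edge_resolution i.+1 (i.+1 + 2))%MS /\
    Z *m const_part (aug_diff edge_resolution i.+1) == 0.
  by apply/andP; rewrite -[_ == 0]orFb -sub_tensor_cycles.
apply/eqP; rewrite eqn_leq; apply/andP; split; apply: mxrankS.
  suff -> : Z = Z *m S by exact: submxMl.
  have Zpart : Z *m tensor_part edge_resolution i.+1 (i.+1 + 2) = Z.
    exact: sub_deg_proj ZP.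
  apply/matrixP=> a r; rewrite mul_mx_diag !mxE.
  have Zdeg r' : (taylor_deg edge_mon r' != i.+1 + 2)%N -> Z a r' = 0.
    move=> /negPf nd; rewrite -Zpart mul_mx_diag !mxE /= nd mulr0.
    by [].
  have [st|nst] := boolP (star_index r); first by rewrite mulr1.
  rewrite mulr0.
  have [dr|/Zdeg//] := boolP (taylor_deg edge_mon r == i.+1 + 2)%N.
  have [e er red] : exists2 e, e \in taylor_set r &
      cover (edge_sets (taylor_set r :\ e)) = cover (edge_sets (taylor_set r)).
    have [/existsP[e /andP[er /eqP]]|none] :=
      boolP [exists e, (e \in taylor_set r) &&
        (cover (edge_sets (taylor_set r :\ e)) == cover (edge_sets (taylor_set r)))].
      by exists e.
    case/negP: nst; apply: (@irredundant_star _ G); first exact: edge_sets_sub.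
      by apply/eqP; rewrite -degE.
    move=> _ /imsetP[e er ->]; rewrite -edge_setsD1.
    by apply: contra none => red; apply/existsP; exists e; rewrite er.
  have [s Ds] : exists s : 'I_(taylor_rank q i.+1), taylor_set s = taylor_set r :\ e.
    by apply: taylor_setP; have := card_taylor_set r; rewrite (cardsD1 e) er => -[].
  have Dr : taylor_set r = e |: taylor_set s by rewrite Ds setD1K.
  have es : e \notin taylor_set s by rewrite Ds !inE eqxx.
  have /matrixP/(_ a s) := Zd; rewrite !mxE (bigD1 r) //= big1 ?addr0.
    rewrite !mxE Dr const_taylor_entry // -Dr.
    have -> : lcm_mon edge_mon (taylor_set r) == lcm_mon edge_mon (taylor_set s).
      by rewrite lcm_edge_eq Ds red.
    by rewrite mulr1 => /eqP; rewrite mulf_eq0 signr_eq0 orbF => /eqP.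
  move=> r' r'r; have [dr'|/Zdeg->] := boolP (taylor_deg edge_mon r' == i.+1 + 2)%N;
    last by rewrite mul0r.
  rewrite !mxE.
  have [->|nz] := eqVneq (taylor_entry k edge_mon (taylor_set r') (taylor_set s)) 0.
    by rewrite mcoeff0 mulr0.
  have [f fs Dr'] := taylor_entry_neq0 nz; rewrite Dr' const_taylor_entry //.
  rewrite lcm_edge_eq -Dr' Ds red; case: eqP => [cov|_]; last by rewrite !mulr0.
  case/eqP: r'r; apply: enum_val_inj; apply: (imset_inj edge_of_inj).
  apply: (forest_cover_inj forestG (edge_sets_sub _) (edge_sets_sub _) (ne0 r)) => //.
    by apply/eqP; rewrite -degE.
  by rewrite !card_edge_sets !card_taylor_set.
rewrite sub_tensor_cycles; apply/andP; split.
  suff <- : S *m tensor_part edge_resolution i.+1 (i.+1 + 2) = S by exact: submxMl.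
  apply/matrixP=> r s; rewrite mul_mx_diag !mxE /=.
  have [<-|] := eqVneq r s; last by rewrite mul0r.
  by case: (boolP (star_index r)) => [/star_deg->|_]; rewrite ?mulr1 ?mul0rn ?mul0r.
apply/orP; right; apply/eqP/matrixP=> r s; rewrite mul_diag_mx !mxE.
have [st|_] := boolP (star_index r); last by rewrite mul0r.
have [->|nz] := eqVneq (taylor_entry k edge_mon (taylor_set r) (taylor_set s)) 0.
  by rewrite mcoeff0 mulr0.
have [f fs Dr] := taylor_entry_neq0 nz.
have fr : f \in taylor_set r by rewrite Dr setU11.
have := star_index_irredundant st fr; rewrite {1}Dr setU1K // => /negPf red.
by rewrite Dr const_taylor_entry // lcm_edge_eq -Dr eq_sym red !mulr0.
Qed.

Lemma rank_tensor_part0 : \rank (tensor_part edge_resolution 0 2) = #|edges G|.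
Proof.
rewrite (rank_tensor_part 0) -[RHS]bin1 -[in RHS](card_ord q) -card_draws.
rewrite -[RHS]card_ord; apply: eq_card => r; rewrite !inE.
have /eqP/cards1P[e ->] := card_taylor_set r.
by rewrite /edge_sets imset_set1 cover1 (card_edge (edge_ofP e)).
Qed.

Lemma card_star_index i : (0 < i)%N ->
  #|star_index (i := i.+1)| =
  (\sum_v 'C(degree G v, i.+1))%N.
Proof.
move=> i0; rewrite -card_stars //.
rewrite -(card_in_imset (f := fun r : 'I_(taylor_rank q i.+1) => edge_sets (taylor_set r))).
  apply: eq_card => C; apply/imsetP/idP => [[r]|].
    rewrite !inE => st ->; rewrite edge_sets_sub card_edge_sets card_taylor_set eqxx.
    exact: st.
  rewrite inE => /and3P[sC /eqP cC stC].
  pose A := edge_of @^-1: C.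
  have AC : edge_sets A = C.
    apply/setP=> f; apply/imsetP/idP => [[e]|fC]; first by rewrite inE => ? ->.
    have [e De] := edge_of_surj (subsetP sC f fC).
    by exists e; rewrite // inE De.
  have [|r Dr] := @taylor_setP q i.+1 A; first by rewrite -card_edge_sets AC.
  by exists r; rewrite ?Dr ?AC // -topredE /= /star_index Dr AC.
move=> r s _ _ /imset_inj => /(_ edge_of_inj); exact: enum_val_inj.
Qed.

End EdgeIdeal.

Theorem corollary2p6 (k : fieldType) (n : nat) (G : simple_graph 'I_n)
    (hG : is_forest G) :
  graded_betti (edge_ideal k G) 0 2 = #|edges G| /\
  (forall i : nat, 1 <= i ->
     graded_betti (edge_ideal k G) i (i + 2) =
       \sum_(v : 'I_n) 'C(degree G v, i.+1)).
Proof.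
split=> [|[//|i] _]; rewrite (graded_bettiE (edge_resolution k G)) /tor_dim.
  rewrite (linear_strand_boundaries k hG 0) mxrank0 subn0.
  exact: rank_tensor_part0.
rewrite linear_strand_boundaries // mxrank0 subn0 rank_linear_strand_cycles //.
exact: card_star_index.
Qed.
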